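(* Let $\mathbf A=(A;\wedge,d)$ be a finite regular SMB algebra and $a,b\in A$. Then the principal congruence $\mathrm{Cg}^{\mathbf A}(a,b)$ equals $D_{\{a,b\}}\circ D_{\{a,b\}}\circ D_{\{a,b\}}$, where $\circ$ is relational composition and $D_{\{a,b\}}$ is the subuniverse of $\mathbf A\times\mathbf A$ generated by $\{(a,b),(b,a)\}\cup\{(c,c):c\in A\}$.
   Context: An algebra $\mathbf A=(A;\wedge,d)$ is idempotent if $x\wedge x=x$ and $d(x,x,x)=x$ for all $x$. For a congruence ${\sim}$ of $\mathbf A$, $\mathbf A$ is an SMB algebra over ${\sim}$ if it is idempotent, $(A/{\sim};\wedge)$ is a semilattice, and on each ${\sim}$-class $\wedge$ acts as the second projection and $d$ acts as a Mal'cev operation ($d(x,y,y)=x=d(y,y,x)$). Write $[u]_{\sim}\le[v]_{\sim}$ iff $[u]_{\sim}\wedge[v]_{\sim}=[u]_{\sim}$. An SMB algebra over ${\sim}$ is regular if (i) $[d(a,b,c)]_{\sim}=[(a\wedge b)\wedge c]_{\sim}$ for all $a,b,c$; (ii) $a\wedge b=b$ whenever $[a]_{\sim}\ge[b]_{\sim}$; (iii) it satisfies $d(x,y,z)\approx d((y\wedge z)\wedge x,(x\wedge z)\wedge y,(x\wedge y)\wedge z)$; (iv) it satisfies $(x\wedge y)\wedge y\approx x\wedge y$. A regular SMB algebra is one that is regular over some congruence. *)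

(* Defs.v *)
From mathcomp Require Import all_boot.
From mathcomp Require Import boolp classical_sets.

Set Implicit Arguments.
Unset Strict Implicit.
Unset Printing Implicit Defensive.

Local Open Scope classical_set_scope.

(* Algebras of signature (2, 3) are unbundled: a carrier with a binary [m]
   (the meet) and a ternary [d]. Binary relations are sets of pairs. *)

Section Algebra.
Variable A : Type.
Variables (m : A -> A -> A) (d : A -> A -> A -> A).

Definition subuniverse (S : set A) : Prop :=
  (forall x y, S x -> S y -> S (m x y)) /\
  (forall x y z, S x -> S y -> S z -> S (d x y z)).

Definition Sg (X : set A) : set A := smallest subuniverse X.

Definition idempotent_algebra : Prop :=
  (forall x, m x x = x) /\ (forall x, d x x x = x).

End Algebra.

Section ProductAlgebra.
Variables A B : Type.

Definition prod_m (mA : A -> A -> A) (mB : B -> B -> B) (p q : A * B) : A * B :=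
  (mA p.1 q.1, mB p.2 q.2).

Definition prod_d (dA : A -> A -> A -> A) (dB : B -> B -> B -> B)
  (p q r : A * B) : A * B := (dA p.1 q.1 r.1, dB p.2 q.2 r.2).

End ProductAlgebra.

Section SMB.
Variable A : Type.
Variables (m : A -> A -> A) (d : A -> A -> A -> A).
Implicit Types (s R : set (A * A)).

Definition equivalence_relation R : Prop :=
  [/\ forall x, R (x, x),
      forall x y, R (x, y) -> R (y, x)
    & forall x y z, R (x, y) -> R (y, z) -> R (x, z)].

Definition congruence R : Prop :=
  equivalence_relation R /\ subuniverse (prod_m m m) (prod_d d d) R.

Definition Cg (a b : A) : set (A * A) := smallest congruence [set (a, b)].

Definition D_pair (a b : A) : set (A * A) :=
  Sg (prod_m m m) (prod_d d d) ([set (a, b); (b, a)] `|` diagonal).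

(* For a congruence [s], an equality [x]_s = [y]_s in the quotient A/s is
   rendered as [s (x, y)], and [x]_s /\ [y]_s is [m x y]_s. *)

Definition quotient_semilattice s : Prop :=
  [/\ forall x, s (m x x, x),
      forall x y, s (m x y, m y x)
    & forall x y z, s (m (m x y) z, m x (m y z))].

Definition class_le s (u v : A) : Prop := s (m u v, u).

Definition SMB_over s : Prop :=
  [/\ idempotent_algebra m d,
      quotient_semilattice s,
      forall x y, s (x, y) -> m x y = y
    & forall x y, s (x, y) -> d x y y = x /\ d y y x = x].

Definition regular_SMB_over s : Prop :=
  [/\ congruence s /\ SMB_over s,
      forall a b c, s (d a b c, m (m a b) c),
      forall a b, class_le s b a -> m a b = b,
      forall x y z,
        d x y z = d (m (m y z) x) (m (m x z) y) (m (m x y) z)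
    & forall x y, m (m x y) y = m x y].

Definition regular_SMB : Prop := exists s, regular_SMB_over s.

End SMB.

(* Main.v *)
Require Import Defs.
From mathcomp Require Import all_boot.
From mathcomp Require Import boolp classical_sets.

(** [D] is a reflexive symmetric compatible relation, so [Cg (a, b)] is its
    transitive closure and it suffices to show that [D \; D \; D] is transitive.
    On a [~]-class the Mal'cev operation makes [D] transitive. Otherwise, every
    element [D]-related to one outside its class lies below [a] or below [b].
    For such an [x], regularity makes [bot x := b /\ (a /\ x)] equal to [b /\ x]
    (resp. [a /\ x]) while [x] equals [a /\ x] (resp. [b /\ x]), so
    [x D (bot x)]. All elements of a [D]-path have their [bot] in one class,
    where [D] is transitive, whence [x D (bot x) D (bot y) D y]. *)

Set Implicit Arguments.
Unset Strict Implicit.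
Unset Printing Implicit Defensive.

Local Open Scope classical_set_scope.
Local Open Scope relation_scope.

(** * Generated subuniverses *)

Section Smallest_subuniverse.
Variables (A : Type) (m : A -> A -> A) (d : A -> A -> A -> A).

Lemma Sg_subuniverse (X : set A) : subuniverse m d (Sg m d X).
Proof.
split=> [x y Sx Sy|x y z Sx Sy Sz] S [cS XS]; have [cm cd] := cS.
  by apply: cm; [apply: Sx | apply: Sy].
by apply: cd; [apply: Sx | apply: Sy | apply: Sz].
Qed.

End Smallest_subuniverse.

(** * The tolerance [D] and its third relational power, in an arbitrary algebra *)

Section Principal_tolerance.
Variables (A : Type) (m : A -> A -> A) (d : A -> A -> A -> A) (a b : A).
Local Notation D := (D_pair m d a b).

Lemma D_pair_gen : D (a, b).
Proof. by apply: sub_gen_smallest; left; left. Qed.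

Lemma D_pair_genC : D (b, a).
Proof. by apply: sub_gen_smallest; left; right. Qed.

Lemma D_pair_refl x : D (x, x).
Proof. by apply: sub_gen_smallest; right. Qed.

Lemma D_pair_m x x' y y' : D (x, x') -> D (y, y') -> D (m x y, m x' y').
Proof. by move=> Dx Dy; apply: (Sg_subuniverse _ _ _).1 Dx Dy. Qed.

Lemma D_pair_d x x' y y' z z' :
  D (x, x') -> D (y, y') -> D (z, z') -> D (d x y z, d x' y' z').
Proof. by move=> Dx Dy Dz; apply: (Sg_subuniverse _ _ _).2 Dx Dy Dz. Qed.

(** The converse of [D] is a subuniverse containing the same generators. *)
Lemma D_pair_sym x y : D (x, y) -> D (y, x).
Proof.
pose S : set (A * A) := [set p | D (p.2, p.1)].
suff : D `<=` S by move=> DS /DS.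
apply: smallest_sub.
  split=> [p q|p q r]; rewrite /S /=; first exact: D_pair_m.
  exact: D_pair_d.
move=> [u v] [[[-> ->]|[-> ->]]|/diagonalP ->]; rewrite /S /=.
- exact: D_pair_genC.
- exact: D_pair_gen.
- exact: D_pair_refl.
Qed.

Lemma D_pair_sub_Cg : D `<=` Cg m d a b.
Proof.
move=> p Dp R [[[Rrefl Rsym Rtrans] Rsub] Rab]; apply: Dp; split=> //.
have {}Rab : R (a, b) by exact: Rab.
by move=> [u v] [[[-> ->]|[-> ->]]|/diagonalP ->] //; apply: Rsym.
Qed.

Lemma Cg_trans x y z :
  Cg m d a b (x, y) -> Cg m d a b (y, z) -> Cg m d a b (x, z).
Proof.
move=> Cxy Cyz R RP; have [[[_ _ Rtrans] _] _] := RP.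
exact: Rtrans (Cxy R RP) (Cyz R RP).
Qed.

Lemma D_pair3P x y :
  (D \; D \; D) (x, y) <-> exists u v, [/\ D (x, u), D (u, v) & D (v, y)].
Proof.
split=> [[v [u Dxu Duv] Dvy]|[u [v [Dxu Duv Dvy]]]]; first by exists u, v.
by exists v => //; exists u.
Qed.

Lemma D_pair3_sub_Cg : D \; D \; D `<=` Cg m d a b.
Proof.
move=> [x y] /D_pair3P[u [v [/D_pair_sub_Cg Cxu /D_pair_sub_Cg Cuv]]].
by move=> /D_pair_sub_Cg Cvy; apply: Cg_trans _ Cvy; apply: Cg_trans _ Cuv.
Qed.

(** Reversing paths gives symmetry, and applying the operations pointwise to paths gives
    compatibility, so only transitivity has to be assumed. *)
Lemma Cg_D_pair3 :
  (forall x y z, (D \; D \; D) (x, y) -> (D \; D \; D) (y, z) ->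
    (D \; D \; D) (x, z)) ->
  Cg m d a b = D \; D \; D.
Proof.
move=> D3trans; apply/seteqP; split; last exact: D_pair3_sub_Cg.
apply: smallest_sub; last first.
  move=> _ ->; apply/D_pair3P; exists b, b.
  by split; [exact: D_pair_gen | exact: D_pair_refl | exact: D_pair_refl].
split; first split=> // [x|x y /D_pair3P[u [v [Dxu Duv Dvy]]]].
- by apply/D_pair3P; exists x, x; split; exact: D_pair_refl.
- by apply/D_pair3P; exists v, u; split; exact: D_pair_sym.
split=> [[x x'] [y y']|[x x'] [y y'] [z z']].
  move=> /D_pair3P[u [v [? ? ?]]] /D_pair3P[u' [v' [? ? ?]]].
  by apply/D_pair3P; exists (m u u'), (m v v'); split; apply: D_pair_m.
move=> /D_pair3P[u [v [? ? ?]]] /D_pair3P[u' [v' [? ? ?]]].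
move=> /D_pair3P[u'' [v'' [? ? ?]]]; apply/D_pair3P.
by exists (d u u' u''), (d v v' v''); split; apply: D_pair_d.
Qed.

End Principal_tolerance.

(** * Classes of a regular SMB algebra and their order *)

Section Regular_SMB.
Variables (A : Type) (m : A -> A -> A) (d : A -> A -> A -> A).
Variables (s : set (A * A)) (a b : A).
Hypothesis smb : regular_SMB_over m d s.
Local Notation D := (D_pair m d a b).

Lemma class_refl x : s (x, x).
Proof. by have [[[[]]]] := smb. Qed.

Lemma class_sym x y : s (x, y) -> s (y, x).
Proof. by have [[[[_ sC _] _] _] _ _ _ _] := smb; exact: sC. Qed.

Lemma class_trans y x z : s (x, y) -> s (y, z) -> s (x, z).
Proof. by have [[[[_ _ sT] _] _] _ _ _ _] := smb; exact: sT. Qed.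

Lemma class_m x x' y y' : s (x, x') -> s (y, y') -> s (m x y, m x' y').
Proof.
by have [[[_ [sm _]] _] _ _ _ _] := smb; move=> sx sy; apply: sm sx sy.
Qed.

Lemma class_mC x y : s (m x y, m y x).
Proof. by have [[_ [_ []]]] := smb. Qed.

#[local] Hint Resolve class_refl class_mC : core.

Lemma class_mA x y z : s (m (m x y) z, m x (m y z)).
Proof. by have [[_ [_ []]]] := smb. Qed.

Lemma class_mm x : s (m x x, x).
Proof. by have [[_ [_ []]]] := smb. Qed.

Lemma class_d x y z : s (d x y z, m (m x y) z).
Proof. by have [] := smb. Qed.

Lemma meet_class_le x y : class_le m s y x -> m x y = y.
Proof. by have [_ _ mle _ _] := smb; exact: mle. Qed.

Lemma class_le_meetl x y z : class_le m s x z -> class_le m s (m x y) z.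
Proof.
rewrite /class_le => xz; apply: class_trans _ (class_m xz (class_refl y)).
apply: class_trans (class_mA _ _ _) _.
apply: class_trans _ (class_sym (class_mA _ _ _)).
exact: class_m.
Qed.

Lemma class_le_congr x y z : s (x, y) -> class_le m s x z -> class_le m s y z.
Proof.
move=> xy xz; apply: class_trans _ (xy); apply: class_trans _ xz.
by apply: class_m => //; exact: class_sym.
Qed.

(* Mal'cev's term applied to the pairs (x, y), (y, y), (y, z). *)
Lemma D_pair_trans_class x y z :
  s (x, y) -> s (y, z) -> D (x, y) -> D (y, z) -> D (x, z).
Proof.
have [[_ [_ _ _ mal]] _ _ _ _] := smb.
move=> sxy syz Dxy Dyz.
rewrite -[x](mal _ _ sxy).1 -[z](mal _ _ (class_sym syz)).2.
by apply: D_pair_d => //; exact: D_pair_refl.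
Qed.

Definition low x := class_le m s x a \/ class_le m s x b.

(** With [a] and [b] as left factors, [meet_class_le] deletes either one as soon as its class lies
    above that of the element to its right. *)
Definition bot x := m b (m a x).

Lemma low_meetl x y : low x -> low (m x y).
Proof. by case=> ?; [left | right]; apply: class_le_meetl. Qed.

Lemma low_congr x y : s (x, y) -> low x -> low y.
Proof. by move=> xy [?|?]; [left | right]; apply: class_le_congr xy _. Qed.

Lemma low_meetr x y : low y -> low (m x y).
Proof. by move=> ly; apply: low_congr (class_mC y x) _; exact: low_meetl. Qed.

Lemma bot_congr x y : s (x, y) -> s (bot x, bot y).
Proof. by move=> xy; do 2!apply: class_m => //. Qed.

Lemma D_pair_botW x y : D (x, y) -> D (bot x, bot y).
Proof. by move=> Dxy; do 2!(apply: D_pair_m; first exact: D_pair_refl). Qed.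

Lemma bot_m x y : s (bot (m x y), m (bot x) y).
Proof.
apply: class_trans _ (class_sym (class_mA _ _ _)); apply: class_m => //.
exact/class_sym/class_mA.
Qed.

(** In the quotient semilattice [bot] is the meet with a fixed element, so its kernel is compatible
    with meets. The factors are replaced one at a time, the second after commuting. *)
Lemma bot_m_congr x x' y y' :
  s (bot x, bot x') -> s (bot y, bot y') -> s (bot (m x y), bot (m x' y')).
Proof.
have half u u' v : s (bot u, bot u') -> s (bot (m u v), bot (m u' v)).
  move=> uu'; apply: class_trans (bot_m _ _) _.
  apply: class_trans _ (class_sym (bot_m _ _)).
  exact: class_m.
move=> xx' yy'; apply: class_trans (half _ _ y xx') _.
apply: class_trans (bot_congr (class_mC _ _)) _.
by apply: class_trans (half _ _ x' yy') _; exact: bot_congr.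
Qed.

Lemma low_D_pair_bot x : low x -> D (x, bot x).
Proof.
case=> [xa|xb]; rewrite /bot.
  rewrite (meet_class_le xa) -{1}(meet_class_le xa).
  by apply: D_pair_m; [exact: D_pair_gen | exact: D_pair_refl].
have axb : class_le m s (m a x) b.
  by apply: class_le_congr (class_mC x a) _; exact: class_le_meetl.
rewrite (meet_class_le axb) -{1}(meet_class_le xb).
by apply: D_pair_m; [exact: D_pair_genC | exact: D_pair_refl].
Qed.

(** An invariant of [D] that depends on the classes only, so that closure under [d] reduces to
    closure under meets. *)
Definition quotient_linked : set (A * A) :=
  [set p | (s p \/ low p.1 /\ low p.2) /\ s (bot p.1, bot p.2)].

Lemma quotient_linked_m p q :
  quotient_linked p -> quotient_linked q -> quotient_linked (prod_m m m p q).
Proof.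
case: p q => [x x'] [y y'] [/= xx' bx] [/= yy' bby].
split=> /=; last exact: bot_m_congr.
case: xx' => [sx|[? ?]]; last by right; split; exact: low_meetl.
case: yy' => [sy|[? ?]]; last by right; split; exact: low_meetr.
by left; exact: class_m.
Qed.

Lemma quotient_linked_congr x x' y y' : s (x, y) -> s (x', y') ->
  quotient_linked (x, x') -> quotient_linked (y, y').
Proof.
move=> xy xy' [/= xx' bx]; split=> /=; last first.
  apply: class_trans (bot_congr (class_sym xy)) _.
  exact: class_trans bx (bot_congr xy').
case: xx' => [sx|[? ?]]; last first.
  by right; split; [exact: low_congr xy _ | exact: low_congr xy' _].
by left; apply: class_trans (class_sym xy) _; exact: class_trans sx xy'.
Qed.

Lemma D_pair_quotient_linked : D `<=` quotient_linked.
Proof.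
(* Both lie in the class of [m b a]. *)
have bab : s (bot a, bot b).
  apply: (@class_trans (m b a)); first by apply: class_m => //; exact: class_mm.
  apply: class_trans _ (class_m (class_refl b) (class_mC b a)).
  apply: class_trans _ (class_mA _ _ _).
  by apply: class_m => //; exact/class_sym/class_mm.
have la : low a by left; exact: class_mm.
have lb : low b by right; exact: class_mm.
apply: smallest_sub.
  split=> [p q|[x x'] [y y'] [z z'] Qx Qy Qz]; first exact: quotient_linked_m.
  (* By regularity [d] acts on classes as the iterated meet. *)
  apply: (quotient_linked_congr (class_sym (class_d x y z))
    (class_sym (class_d x' y' z'))).
  exact: quotient_linked_m (quotient_linked_m Qx Qy) Qz.
move=> [u v] [[[-> ->]|[-> ->]]|/diagonalP ->].
- by split=> //; right.
- by split; [right | exact: class_sym].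
- by split; [left |].
Qed.

(** A description of the threefold composite in which every use of [D] stays inside one class, where
    [D] is transitive. *)
Definition linked x y := s (x, y) /\ D (x, y) \/
  [/\ low x, low y, s (bot x, bot y) & D (bot x, bot y)].

Lemma D_pair_linked x y : D (x, y) -> linked x y.
Proof.
move=> Dxy; have [/= [sxy|[lx ly]] bxy] := D_pair_quotient_linked Dxy.
  by left.
by right; split=> //; exact: D_pair_botW.
Qed.

(** In the mixed cases [bot] carries the step inside a class to a [D]-step between elements of the
    class of the other two bottoms, and [low] passes along the class. *)
Lemma linked_trans x y z : linked x y -> linked y z -> linked x z.
Proof.
move=> [[sxy Dxy]|[lx ly sxy Dxy]] [[syz Dyz]|[ly' lz syz Dyz]].
- left; split; first exact: class_trans _ syz.
  exact: D_pair_trans_class Dxy Dyz.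
- right; have sbxy := bot_congr sxy; split=> //.
  + exact: low_congr (class_sym sxy) _.
  + exact: class_trans _ syz.
  + by apply: D_pair_trans_class _ Dyz => //; exact: D_pair_botW.
- right; have sbyz := bot_congr syz; split=> //.
  + exact: low_congr syz _.
  + exact: class_trans _ sbyz.
  + by apply: D_pair_trans_class Dxy _ => //; exact: D_pair_botW.
- right; split=> //; first exact: class_trans _ syz.
  exact: D_pair_trans_class Dxy Dyz.
Qed.

Lemma D_pair3_linked x y : (D \; D \; D) (x, y) <-> linked x y.
Proof.
split=> [/D_pair3P[u [v [/D_pair_linked xu /D_pair_linked uv]]]|].
  move=> /D_pair_linked vy; apply: linked_trans _ vy.
  exact: linked_trans uv.
move=> [[_ Dxy]|[lx ly _ Dxy]]; apply/D_pair3P.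
  by exists x, x; split=> //; exact: D_pair_refl.
exists (bot x), (bot y); split=> //; first exact: low_D_pair_bot.
by apply: D_pair_sym; exact: low_D_pair_bot.
Qed.

Lemma Cg_regular_SMB : Cg m d a b = D \; D \; D.
Proof.
apply: Cg_D_pair3 => x y z /D_pair3_linked xy /D_pair3_linked yz.
by apply/D_pair3_linked; exact: linked_trans _ yz.
Qed.

End Regular_SMB.

Theorem theorem6p3 (A : finType) (m : A -> A -> A) (d : A -> A -> A -> A)
    (a b : A) (hA : regular_SMB m d) :
  Cg m d a b = (D_pair m d a b \; D_pair m d a b \; D_pair m d a b)%relation.
Proof. by case: hA => s smb; apply: Cg_regular_SMB smb. Qed.
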